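(* Let $(\mathfrak{g},[\cdot,\cdot,\cdot],\alpha)$ be a $3$-Hom-Lie algebra and let $(V;\rho,\nu,A)$ be a generalized representation of $\mathfrak{g}$ with respect to $A\in \mathfrak{gl}(V)$. Define a trilinear bracket on $\mathfrak{g}\oplus V$ by $$[x+u,y+v,z+w]_{(\rho,\nu)}=[x,y,z]+\rho(x,y)(w)+\rho(y,z)(u)+\rho(z,x)(v)+\nu(x)(v\wedge w)+\nu(y)(w\wedge u)+\nu(z)(u\wedge v)$$ for $x,y,z\in\mathfrak{g}$, $u,v,w\in V$, and let $\alpha_{\mathfrak{g}\oplus V}=\alpha+A$, i.e. $\alpha_{\mathfrak{g}\oplus V}(x+u)=\alpha(x)+A(u)$. Then $(\mathfrak{g}\oplus V,[\cdot,\cdot,\cdot]_{(\rho,\nu)},\alpha_{\mathfrak{g}\oplus V})$ is a $3$-Hom-Lie algebra.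
   Context: All vector spaces are over a field $\mathbb{K}$ of characteristic $0$; $\mathfrak{gl}(V)=\mathrm{End}(V)$. A $3$-Hom-Lie algebra is a triple $(\mathfrak{g},[\cdot,\cdot,\cdot],\alpha)$: a vector space $\mathfrak{g}$, a trilinear skew-symmetric bracket, and a linear map $\alpha:\mathfrak g\to\mathfrak g$ with $\alpha[x,y,z]=[\alpha(x),\alpha(y),\alpha(z)]$, satisfying for all $x,y,z,u,v\in\mathfrak g$ $$[\alpha(u),\alpha(v),[x,y,z]]=[[u,v,x],\alpha(y),\alpha(z)]+[\alpha(x),[u,v,y],\alpha(z)]+[\alpha(x),\alpha(y),[u,v,z]].$$ Bracket in degree one. For a vector space $W$ with a linear map $\gamma:W\to W$, and a linear map $\Pi:\wedge^3W\to W$ with $\gamma\circ\Pi=\Pi\circ\gamma^{\otimes 3}$, the bracket $[\Pi,\Pi]^{3HL}:(\wedge^2W)^{\otimes 2}\otimes W\to W$ is $$[\Pi,\Pi]^{3HL}(a\wedge b,c\wedge d,e)=-2\big(\Pi(\Pi(a,b,c),\gamma d,\gamma e)+\Pi(\gamma c,\Pi(a,b,d),\gamma e)+\Pi(\gamma c,\gamma d,\Pi(a,b,e))-\Pi(\gamma a,\gamma b,\Pi(c,d,e))\big).$$ Generalized representation. Let $\pi$ denote the bracket of $\mathfrak g$. Given $A\in\mathfrak{gl}(V)$ and linear maps $\rho:\wedge^2\mathfrak g\to\mathfrak{gl}(V)$, $\nu:\mathfrak g\to\mathrm{Hom}(\wedge^2V,V)$, regard $\pi$ as a map $\wedge^3(\mathfrak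 g\oplus V)\to\mathfrak g\oplus V$ (zero when an argument is in $V$), and put $\overline\rho(x+u,y+v,z+w)=\rho(x,y)(w)+\rho(y,z)(u)+\rho(z,x)(v)$ and $\overline\nu(x+u,y+v,z+w)=\nu(x)(v\wedge w)+\nu(y)(w\wedge u)+\nu(z)(u\wedge v)$. Then $(V;\rho,\nu,A)$ is a generalized representation of $\mathfrak g$ with respect to $A$ if $\Pi=\pi+\overline\rho+\overline\nu$ commutes with $\gamma=\alpha+A$ (that is, $\gamma\circ\Pi=\Pi\circ\gamma^{\otimes3}$, so that the bracket is defined) and $[\Pi,\Pi]^{3HL}=0$ on $W=\mathfrak g\oplus V$. *)

(* Defs.v *)
From HB Require Import structures.
From mathcomp Require Import all_boot all_order all_algebra.

Set Implicit Arguments.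
Unset Strict Implicit.
Unset Printing Implicit Defensive.

Import GRing.Theory.
Local Open Scope ring_scope.

Definition trilinear (K : fieldType) (U1 U2 U3 W : lmodType K)
    (f : U1 -> U2 -> U3 -> W) : Prop :=
  [/\ forall y z, linear (fun x => f x y z),
      forall x z, linear (fun y => f x y z)
    & forall x y, linear (fun z => f x y z)].

(* Skew-symmetry under adjacent transpositions, which generate S_3.  In
   characteristic 0 the skew-symmetric trilinear maps W x W x W -> W are exactly
   the linear maps from the third exterior power of W to W. *)
Definition skew3 (K : fieldType) (W : lmodType K) (f : W -> W -> W -> W) : Prop :=
  (forall x y z, f y x z = - f x y z) /\ (forall x y z, f x z y = - f x y z).

Record is_3HomLie (K : fieldType) (g : lmodType K)
    (br : g -> g -> g -> g) (alpha : g -> g) : Prop := Is3HomLie {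
  hl_trilinear : trilinear br;
  hl_skew : skew3 br;
  hl_linear : linear alpha;
  hl_mult : forall x y z, alpha (br x y z) = br (alpha x) (alpha y) (alpha z);
  hl_fundamental : forall x y z u v,
    br (alpha u) (alpha v) (br x y z) =
      br (br u v x) (alpha y) (alpha z) + br (alpha x) (br u v y) (alpha z)
      + br (alpha x) (alpha y) (br u v z)
}.

(* The degree-one bracket [Pi, Pi]^{3HL}, evaluated at (a ^ b, c ^ d, e).  It is
   a total expression here; the condition that gamma commutes with Pi is imposed
   where the bracket is used. *)
Definition bracket3HL (K : fieldType) (W : lmodType K) (gamma : W -> W)
    (Pi : W -> W -> W -> W) (a b c d e : W) : W :=
  (- 2%:R : K) *: (Pi (Pi a b c) (gamma d) (gamma e)
                   + Pi (gamma c) (Pi a b d) (gamma e)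
                   + Pi (gamma c) (gamma d) (Pi a b e)
                   - Pi (gamma a) (gamma b) (Pi c d e)).

(* In the rest of the file g (+) V is the product module (g * V), x + u is the
   pair (x, u), rho x y w is rho(x, y)(w) and nu x v w is nu(x)(v ^ w). *)

Definition pi_ext (K : fieldType) (g V : lmodType K) (br : g -> g -> g -> g)
    (p q r : (g * V)%type) : (g * V)%type :=
  (br p.1 q.1 r.1, 0).

Definition rho_ext (K : fieldType) (g V : lmodType K) (rho : g -> g -> V -> V)
    (p q r : (g * V)%type) : (g * V)%type :=
  (0, rho p.1 q.1 r.2 + rho q.1 r.1 p.2 + rho r.1 p.1 q.2).

Definition nu_ext (K : fieldType) (g V : lmodType K) (nu : g -> V -> V -> V)
    (p q r : (g * V)%type) : (g * V)%type :=
  (0, nu p.1 q.2 r.2 + nu q.1 r.2 p.2 + nu r.1 p.2 q.2).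

Definition Pi_ext (K : fieldType) (g V : lmodType K) (br : g -> g -> g -> g)
    (rho : g -> g -> V -> V) (nu : g -> V -> V -> V)
    (p q r : (g * V)%type) : (g * V)%type :=
  pi_ext br p q r + rho_ext rho p q r + nu_ext nu p q r.

Definition sum_map (K : fieldType) (g V : lmodType K)
    (alpha : g -> g) (A : V -> V) (p : (g * V)%type) : (g * V)%type :=
  (alpha p.1, A p.2).

(* The first five fields say that A is in gl(V), rho is a linear map from the
   second exterior power of g to gl(V), and nu is a linear map from g to
   Hom(/\^2 V, V). *)
Record generalized_rep (K : fieldType) (g V : lmodType K)
    (br : g -> g -> g -> g) (alpha : g -> g)
    (rho : g -> g -> V -> V) (nu : g -> V -> V -> V) (A : V -> V) : Prop :=
  GeneralizedRep {
  gr_linear : linear A;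
  gr_rho_trilinear : trilinear rho;
  gr_rho_skew : forall x y w, rho y x w = - rho x y w;
  gr_nu_trilinear : trilinear nu;
  gr_nu_skew : forall x v w, nu x w v = - nu x v w;
  gr_commutes : forall p q r : (g * V)%type,
    sum_map alpha A (Pi_ext br rho nu p q r) =
    Pi_ext br rho nu
      (sum_map alpha A p) (sum_map alpha A q) (sum_map alpha A r);
  gr_bracket0 : forall a b c d e : (g * V)%type,
    bracket3HL (sum_map alpha A) (Pi_ext br rho nu) a b c d e = 0
}.

Definition semidirect_bracket (K : fieldType) (g V : lmodType K)
    (br : g -> g -> g -> g) (rho : g -> g -> V -> V) (nu : g -> V -> V -> V)
    (p q r : (g * V)%type) : (g * V)%type :=
  let: (x, u) := p in
  let: (y, v) := q in
  let: (z, w) := r in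
  (br x y z,
   rho x y w + rho y z u + rho z x v + nu x v w + nu y w u + nu z u v).

(* Main.v *)
Require Import Defs.
From HB Require Import structures.
From mathcomp Require Import all_boot all_order all_algebra.

Set Implicit Arguments.
Unset Strict Implicit.
Unset Printing Implicit Defensive.

Import GRing.Theory.
Local Open Scope ring_scope.

(** The bracket on [g * V] is the map [Pi = pi + rho_ext + nu_ext], so a
generalized representation is by definition one for which [Pi] commutes with
[alpha + A] and has vanishing square [Pi, Pi].  Evaluated at
(u ^ v, x ^ y, z), that square is -2 times the difference of the two sides of
the fundamental identity; since 2 is invertible in characteristic 0, the
identity follows ([bracket3HL0_fundamental]).

It remains to see that [Pi] is trilinear and skew-symmetric.  Each of its three
parts is unchanged under cyclic rotation of the arguments: [br] because
3-cycles are even, the other two because they are cyclic sums.  By rotation,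
linearity in the first slot gives trilinearity, and antisymmetry in the first
two slots gives full skew-symmetry. *)

Section CyclicMaps.

Variables (K : fieldType) (W : lmodType K) (f : W -> W -> W -> W).
Hypothesis f_rot : forall x y z, f x y z = f y z x.

(** A rotation carries any chosen slot to the first one. *)
Lemma trilinear_of_rot :
  (forall y z, linear (fun x => f x y z)) -> trilinear f.
Proof.
move=> f_lin; split=> [//|x z a y y'|x y a z z'].
- by rewrite !(f_rot x) f_lin.
- by rewrite -!(f_rot _ x y) f_lin.
Qed.

(** The transposition of the last two slots is the one of the first two
conjugated by a rotation. *)
Lemma skew3_of_rot : (forall x y z, f y x z = - f x y z) -> skew3 f.
Proof. by move=> f_anti; split=> // x y z; rewrite f_rot f_anti (f_rot x y). Qed.

End CyclicMaps.

Lemma skew3_rot (K : fieldType) (W : lmodType K) (f : W -> W -> W -> W) :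
  skew3 f -> forall x y z, f x y z = f y z x.
Proof. by case=> f12 f23 x y z; rewrite -[LHS]opprK -f12 -f23. Qed.

(** Characteristic 0 enters here, to cancel the scalar -2 in front of the
square. *)
Lemma bracket3HL0_fundamental (K : fieldType) (W : lmodType K)
    (gamma : W -> W) (Pi : W -> W -> W -> W) (u v x y z : W) :
    [pchar K] =i pred0 ->
    bracket3HL gamma Pi u v x y z = 0 ->
  Pi (gamma u) (gamma v) (Pi x y z) =
    Pi (Pi u v x) (gamma y) (gamma z) + Pi (gamma x) (Pi u v y) (gamma z)
    + Pi (gamma x) (gamma y) (Pi u v z).
Proof.
move=> charK0 /eqP; rewrite /bracket3HL scaler_eq0 oppr_eq0.
by rewrite ((pcharf0P K).1 charK0) /= subr_eq0 => /eqP.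
Qed.

Section SemidirectBracket.

Variables (K : fieldType) (g V : lmodType K) (br : g -> g -> g -> g).
Variables (rho : g -> g -> V -> V) (nu : g -> V -> V -> V).

Lemma Pi_extE p q r :
  Pi_ext br rho nu p q r = semidirect_bracket br rho nu p q r.
Proof.
case: p q r => [x u] [y v] [z w].
by congr pair; rewrite /= ?addr0 // add0r !addrA.
Qed.

Lemma semidirect_bracket_rot : skew3 br -> forall p q r,
  semidirect_bracket br rho nu p q r = semidirect_bracket br rho nu q r p.
Proof.
move=> br_skew [x u] [y v] [z w] /=; congr pair; first exact: skew3_rot.
by rewrite [LHS](ACl (2*3*1*5*6*4)) /=.
Qed.

Lemma semidirect_bracket_linearl :
    trilinear br -> trilinear rho -> trilinear nu ->
  forall q r, linear (fun p => semidirect_bracket br rho nu p q r).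
Proof.
move=> [br1 _ _] [rho1 rho2 rho3] [nu1 nu2 nu3] [y v] [z w] a [x u] [x' u'].
congr pair; first exact: br1.
have linD (s s' t t' : V) :
    (a *: s + s') + (a *: t + t') = a *: (s + t) + (s' + t').
  by rewrite addrACA -scalerDr.
by rewrite /= rho1 rho2 rho3 nu1 nu2 nu3 !linD.
Qed.

Lemma semidirect_bracket_anti :
    skew3 br -> (forall x y w, rho y x w = - rho x y w) ->
    (forall x v w, nu x w v = - nu x v w) ->
  forall p q r,
  semidirect_bracket br rho nu q p r = - semidirect_bracket br rho nu p q r.
Proof.
move=> [br12 _] rho_anti nu_anti [x u] [y v] [z w].
congr pair; first exact: br12.
(* Swapping p and q fixes one rho-term and one nu-term up to sign and exchanges
   the two others of each kind; the final rewrites undo these exchanges. *)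
rewrite /= (rho_anti x y) (rho_anti z x) (rho_anti y z).
rewrite (nu_anti y w u) (nu_anti x v w) (nu_anti z u v) !opprD.
by rewrite [_ - rho z x v - _]addrAC [X in X - nu z u v]addrAC.
Qed.

End SemidirectBracket.

Theorem theorem2p4 (K : fieldType) (charK0 : [pchar K] =i pred0)
    (g V : lmodType K) (br : g -> g -> g -> g) (alpha : g -> g)
    (rho : g -> g -> V -> V) (nu : g -> V -> V -> V) (A : V -> V)
    (g3HL : is_3HomLie br alpha)
    (Vrep : generalized_rep br alpha rho nu A) :
  is_3HomLie (semidirect_bracket br rho nu) (sum_map alpha A).
Proof.
case: g3HL => br_lin br_skew alpha_lin _ _.
case: Vrep => A_lin rho_lin rho_anti nu_lin nu_anti Pi_comm Pi_sq0.
have rot := semidirect_bracket_rot rho nu br_skew.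
split.
- exact: trilinear_of_rot rot (semidirect_bracket_linearl br_lin rho_lin nu_lin).
- exact: skew3_of_rot rot (semidirect_bracket_anti br_skew rho_anti nu_anti).
- by move=> a [x u] [x' u']; congr pair; [apply: alpha_lin | apply: A_lin].
- by move=> p q r; rewrite -!Pi_extE.
- move=> x y z u v; rewrite -!Pi_extE.
  exact: bracket3HL0_fundamental charK0 (Pi_sq0 u v x y z).
Qed.
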